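(* Let $(A,[-,-,-]_1,[-,-,-]_2)$ be a compatible ternary Leibniz algebra and let $\beta:A\to A$ be an injective averaging operator on $A$ for both $[-,-,-]_1$ and $[-,-,-]_2$. Then $A^\beta:=(A,[-,-,-]_1^\beta,[-,-,-]_2^\beta)$ is a compatible ternary Leibniz algebra, where $[x,y,z]_i^\beta=[\beta(x),\beta(y),z]_i$ for $x,y,z\in A$, $i=1,2$. Moreover, $\beta:(A,[-,-,-]^\beta)\to(A,[-,-,-])$ is a morphism of ternary Leibniz algebras, where $[-,-,-]=[-,-,-]_1+[-,-,-]_2$ and $[-,-,-]^\beta=[-,-,-]_1^\beta+[-,-,-]_2^\beta$.
   Context: Vector spaces are over a field $\mathbb{K}$. A ternary Leibniz algebra is a vector space $L$ with a trilinear map $[-,-,-]:L\times L\times L\to L$ such that $[[x,y,z],t,u]=[x,y,[z,t,u]]+[x,[y,t,u],z]+[[x,t,u],y,z]$ for all $x,y,z,t,u\in L$. A morphism of ternary Leibniz algebras is a linear map preserving brackets. A compatible ternary Leibniz algebra is a triple $(L,[-,-,-]_1,[-,-,-]_2)$ where both $(L,[-,-,-]_1)$ and $(L,[-,-,-]_2)$ are ternary Leibniz algebras and for all $x,y,z,t,u\in L$ $$[[x,y,z]_1,t,u]_2+[[x,y,z]_2,t,u]_1=[x,y,[z,t,u]_1]_2+[x,y,[z,t,u]_2]_1+[x,[y,t,u]_1,z]_2+[x,[y,t,u]_2,z]_1+[[x,t,u]_1,y,z]_2+[[x,t,u]_2,y,z]_1.$$ An averaging operator on a ternary Leibniz algebra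 $L$ is a linear map $\beta:L\to L$ such that for all $x,y,z\in L$ $$\beta([\beta(x),\beta(y),z])=\beta([\beta(x),y,\beta(z)])=\beta([x,\beta(y),\beta(z)])=[\beta(x),\beta(y),\beta(z)].$$ *)

(* Defs.v *)
From mathcomp Require Import all_boot all_order all_algebra.

Set Implicit Arguments.
Unset Strict Implicit.
Unset Printing Implicit Defensive.

Import GRing.Theory.
Local Open Scope ring_scope.

Section TernaryLeibniz.

Variables (K : fieldType) (L : lmodType K).

Implicit Types (br : L -> L -> L -> L).

Definition trilinear br : Prop :=
  [/\ forall y z, linear (fun x => br x y z),
      forall x z, linear (fun y => br x y z)
    & forall x y, linear (fun z => br x y z)].

Definition ternary_leibniz_identity br : Prop :=
  forall x y z t u,
    br (br x y z) t u =
      br x y (br z t u) + br x (br y t u) z + br (br x t u) y z.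

Definition ternary_leibniz_algebra br : Prop :=
  trilinear br /\ ternary_leibniz_identity br.

Definition compatibility_identity br1 br2 : Prop :=
  forall x y z t u,
    br2 (br1 x y z) t u + br1 (br2 x y z) t u =
      br2 x y (br1 z t u) + br1 x y (br2 z t u)
      + br2 x (br1 y t u) z + br1 x (br2 y t u) z
      + br2 (br1 x t u) y z + br1 (br2 x t u) y z.

Definition compatible_ternary_leibniz_algebra br1 br2 : Prop :=
  [/\ ternary_leibniz_algebra br1, ternary_leibniz_algebra br2
    & compatibility_identity br1 br2].

Definition averaging_operator br (beta : L -> L) : Prop :=
  linear beta /\
  forall x y z,
    [/\ beta (br (beta x) (beta y) z) = beta (br (beta x) y (beta z)),
        beta (br (beta x) y (beta z)) = beta (br x (beta y) (beta z))
      & beta (br x (beta y) (beta z)) = br (beta x) (beta y) (beta z)].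

Definition twisted_bracket (beta : L -> L) br : L -> L -> L -> L :=
  fun x y z => br (beta x) (beta y) z.

Definition sum_bracket br1 br2 : L -> L -> L -> L :=
  fun x y z => br1 x y z + br2 x y z.

End TernaryLeibniz.

(* A morphism carries the requirement that its source and target are ternary
   Leibniz algebras, since the brackets are mere functions here. *)
Definition ternary_leibniz_morphism (K : fieldType) (L L' : lmodType K)
    (br : L -> L -> L -> L) (br' : L' -> L' -> L' -> L') (f : L -> L') : Prop :=
  [/\ ternary_leibniz_algebra br, ternary_leibniz_algebra br', linear f
    & forall x y z, f (br x y z) = br' (f x) (f y) (f z)].

(* Main.v *)
Require Import Defs.
From mathcomp Require Import all_boot all_order all_algebra.

(** An averaging operator turns a bracket into its twist in such a way that it
    intertwines the two: [beta (twisted_bracket beta br x y z)] equals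
    [br (beta x) (beta y) (beta z)].  Both the ternary Leibniz identity and the
    compatibility identity are equalities between sums of iterated brackets, so
    [beta] carries each of them for the twisted brackets to the same identity
    for the original ones, evaluated at the images of the variables.  Since
    [beta] is additive and injective, the identities for the twisted brackets
    follow ([ternary_leibniz_pullback], [compatibility_pullback]).

    For the morphism statement, the Leibniz identity of [br1 + br2] expands by
    multilinearity into the two individual Leibniz identities plus the mixed
    terms, and the latter are exactly the compatibility identity
    ([sum_ternary_leibniz_algebra]).  This applies to the original pair and, by
    the first half, to the twisted pair. *)

Import GRing.Theory.
Local Open Scope ring_scope.

Lemma linear_additive {K : fieldType} {U V : lmodType K} {f : U -> V} :
  linear f -> {morph f : x y / x + y}.
Proof. by move=> fL x y; rewrite -[x in LHS]scale1r fL scale1r. Qed.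

Section Pullback.

Variables (K : fieldType) (L L' : lmodType K) (f : L -> L').
Hypotheses (fL : linear f) (f_inj : injective f).

Lemma ternary_leibniz_pullback (br : L -> L -> L -> L)
    (br' : L' -> L' -> L' -> L') :
  (forall x y z, f (br x y z) = br' (f x) (f y) (f z)) ->
  ternary_leibniz_identity br' -> ternary_leibniz_identity br.
Proof.
move=> fM leib x y z t u; apply: f_inj.
by rewrite !(linear_additive fL) !fM leib.
Qed.

Lemma compatibility_pullback (br1 br2 : L -> L -> L -> L)
    (br1' br2' : L' -> L' -> L' -> L') :
  (forall x y z, f (br1 x y z) = br1' (f x) (f y) (f z)) ->
  (forall x y z, f (br2 x y z) = br2' (f x) (f y) (f z)) ->
  compatibility_identity br1' br2' -> compatibility_identity br1 br2.
Proof.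
move=> fM1 fM2 compat x y z t u; apply: f_inj.
by rewrite !(linear_additive fL) !(fM1, fM2) compat.
Qed.

End Pullback.

Section Brackets.

Variables (K : fieldType) (L : lmodType K).
Implicit Types (br : L -> L -> L -> L) (beta : L -> L).

Lemma twisted_trilinear br beta :
  linear beta -> trilinear br -> trilinear (twisted_bracket beta br).
Proof.
move=> bL [brl brm brr]; rewrite /twisted_bracket.
split=> v w a x y /=; last exact: brr.
- by rewrite bL brl.
- by rewrite bL brm.
Qed.

(** The three averaging equations chain together to say that the operator
    intertwines the twisted bracket with the original one. *)
Lemma averaging_twisted br beta : averaging_operator br beta ->
  forall x y z,
    beta (twisted_bracket beta br x y z) = br (beta x) (beta y) (beta z).
Proof. by case=> _ avg x y z; have [-> -> ->] := avg x y z. Qed.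

Lemma twisted_ternary_leibniz_algebra br beta :
  averaging_operator br beta -> injective beta ->
  ternary_leibniz_algebra br ->
  ternary_leibniz_algebra (twisted_bracket beta br).
Proof.
move=> avg b_inj [brL leib]; have [bL _] := avg; split.
  exact: twisted_trilinear.
exact: (ternary_leibniz_pullback _ _ _ _ bL b_inj _ _
          (averaging_twisted _ _ avg)).
Qed.

Lemma sum_trilinear br1 br2 :
  trilinear br1 -> trilinear br2 -> trilinear (sum_bracket br1 br2).
Proof.
move=> [l1 m1 r1] [l2 m2 r2]; rewrite /sum_bracket.
split=> v w a x y /=.
- by rewrite l1 l2 scalerDr addrACA.
- by rewrite m1 m2 scalerDr addrACA.
- by rewrite r1 r2 scalerDr addrACA.
Qed.

(** In the expanded Leibniz identity of the sum, the terms using a single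
    bracket balance by that bracket's own identity, and compatibility says that
    the terms mixing the two brackets balance as well. *)
Lemma sum_ternary_leibniz_algebra br1 br2 :
  compatible_ternary_leibniz_algebra br1 br2 ->
  ternary_leibniz_algebra (sum_bracket br1 br2).
Proof.
move=> [[tri1 leib1] [tri2 leib2] compat]; split; first exact: sum_trilinear.
have [l1 m1 r1] := tri1; have [l2 m2 r2] := tri2.
move=> x y z t u; rewrite /sum_bracket.
rewrite (linear_additive (l1 t u)) (linear_additive (l2 t u)).
rewrite (linear_additive (r1 x y)) (linear_additive (r2 x y)).
rewrite (linear_additive (m1 x z)) (linear_additive (m2 x z)).
rewrite (linear_additive (l1 y z)) (linear_additive (l2 y z)).
(* Group the two pure terms and the two mixed terms on the left; after
   expansion, twelve terms remain to be sorted by outer slot. *)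
rewrite [LHS](AC (2*2) ((1*4)*(3*2))) /= leib1 leib2 compat.
by rewrite [LHS](AC ((3*3)*6)
  (((1*8)*(7*4)) * ((2*10)*(9*5)) * ((3*12)*(11*6))))%AC.
Qed.

End Brackets.

Theorem proposition3p8 (K : fieldType) (A : lmodType K)
    (br1 br2 : A -> A -> A -> A) (beta : A -> A)
    (hA : compatible_ternary_leibniz_algebra br1 br2)
    (hbeta1 : averaging_operator br1 beta)
    (hbeta2 : averaging_operator br2 beta)
    (hinj : injective beta) :
  compatible_ternary_leibniz_algebra
    (twisted_bracket beta br1) (twisted_bracket beta br2) /\
  ternary_leibniz_morphism
    (sum_bracket (twisted_bracket beta br1) (twisted_bracket beta br2))
    (sum_bracket br1 br2)
    beta.
Proof.
have [leib1 leib2 compat] := hA; have [bL _] := hbeta1.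
have fM1 := averaging_twisted _ _ _ _ hbeta1.
have fM2 := averaging_twisted _ _ _ _ hbeta2.
have twA : compatible_ternary_leibniz_algebra
    (twisted_bracket beta br1) (twisted_bracket beta br2).
  split; try exact: twisted_ternary_leibniz_algebra.
  exact: (compatibility_pullback _ _ _ _ bL hinj _ _ _ _ fM1 fM2).
split=> //; split=> //; try exact: sum_ternary_leibniz_algebra.
by move=> x y z; rewrite /sum_bracket (linear_additive bL) fM1 fM2.
Qed.
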